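(* Suppose Assumptions A and B (stated in the context) hold, with $h_0$ as in Assumption B. Then there is a constant $Q>0$, independent of $h$ and $t$, such that for every $0<h<h_0$ every solution $(u_h,v_h)$ of the semi-discrete scheme (stated in the context) satisfies $$\|\nabla u_h(t)\|+\|\nabla v_h(t)\|\le Q\qquad\text{for all } t\in[0,T].$$
   Context: $\Omega\subset\mathbb R^d$ ($1\le d\le3$) is a bounded domain with smooth boundary; $(\cdot,\cdot)$, $\|\cdot\|$ are the $L^2(\Omega)$ inner product and norm; $\beta,\gamma,T>0$ are fixed. The initial data are $u_0,v_0\in H^2(\Omega)\cap H^1_0(\Omega)$ with $\|v_0\|=1$. For mesh size $h$, $S_h\subset H^1_0(\Omega)$ is the space of continuous piecewise linear functions on a quasi-uniform partition of $\Omega$ of mesh size $h$, and $P:H^1_0(\Omega)\to S_h$ is the elliptic projection, $(\nabla(g-Pg),\nabla\chi)=0$ for all $\chi\in S_h$, which satisfies $\|g-Pg\|+h\|\nabla(g-Pg)\|\le Qh^2\|g\|_{H^2}$ for all $g\in H^2(\Omega)\cap H^1_0(\Omega)$ with $Q$ independent of $h$ and $g$. Mesh sizes are assumed small enough that $\|Pv_0\|\ge 1/2$. Semi-discrete scheme: find $u_h(t),v_h(t)\in S_h$, $t\in[0,T]$, such that for all $\chi_1,\chi_2\in S_h$ $$\beta^{-1}(u_{h,t},\chi_1)+(\nabla u_h,\nabla\chi_1)-2(\nabla v_h,\nabla u_h)(v_h,\chi_1)=(f(u_h),\chi_1)-2(v_h,f(u_h))(v_h,\chi_1),$$ $$\gamma^{-1}(v_{h,t},\chi_2)+(\nabla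 v_h,\nabla\chi_2)-(\nabla v_h,\nabla v_h)(v_h,\chi_2)=(f'(u_h)v_h,\chi_2)-(v_h,f'(u_h)v_h)(v_h,\chi_2),$$ with $u_h(0)=Pu_0$ and $v_h(0)=Pv_0/\|Pv_0\|$. Assumption A: $f$ and $f'$ are locally Lipschitz on $\mathbb R$: for every $r>0$ there is $L_r>0$ with $|f(z_1)-f(z_2)|+|f'(z_1)-f'(z_2)|\le L_r|z_1-z_2|$ for all $-r\le z_1,z_2\le r$. Assumption B: there exist $h_0>0$ and $C_0>0$ such that for any $0<h<h_0$ the solution component $u_h$ of the semi-discrete scheme, if it exists, satisfies $\|u_h\|_{L^\infty(0,T;L^\infty(\Omega))}\le C_0$. The constant $Q$ may depend on $T$, the data ($\Omega,f,\beta,\gamma,u_0,v_0$) and $C_0$, but not on $h$. *)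

(* Defs.v *)
From HB Require Import structures.
From mathcomp Require Import all_boot all_order all_algebra.
From mathcomp Require Import all_classical all_reals all_analysis.
From mathcomp Require Import ess_sup_inf.

Set Implicit Arguments.
Unset Strict Implicit.
Unset Printing Implicit Defensive.

Import Order.TTheory GRing.Theory Num.Theory.
Import numFieldNormedType.Exports.

Local Open Scope classical_set_scope.
Local Open Scope ring_scope.

Definition measure_rV_display : measure_display -> measure_display.
Proof. exact. Qed.

Section measurable_rV.
Context {R : realType}.
Variable n : nat.

Let coor : 'I_n -> 'rV[R]_n -> measurableTypeR R := fun i x => x ord0 i.

Let rV_set0 : g_sigma_preimage coor set0.
Proof. exact: sigma_algebra0. Qed.

Let rV_setC A : g_sigma_preimage coor A -> g_sigma_preimage coor (~` A).
Proof. exact: sigma_algebraC. Qed.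

Let rV_bigcup (F : _^nat) : (forall i, g_sigma_preimage coor (F i)) ->
  g_sigma_preimage coor (\bigcup_i (F i)).
Proof. exact: sigma_algebra_bigcup. Qed.

(* The sigma-algebra generated by the coordinates, i.e. the Borel one. *)
HB.instance Definition _ := @isMeasurable.Build
  (measure_rV_display default_measure_display)
  'rV[R]_n (g_sigma_preimage coor) rV_set0 rV_setC rV_bigcup.

End measurable_rV.

Section measurable_coordinates.
Context {R : realType}.

Lemma measurable_coord n (i : 'I_n) :
  measurable_fun [set: 'rV[R]_n] (fun x : 'rV[R]_n => x ord0 i).
Proof.
move=> _ Y mY; rewrite setTI; apply: sub_sigma_algebra => /=.
rewrite -bigcup_seq/=; exists i => /=; first by rewrite mem_index_enum.
by exists Y => //; rewrite setTI.
Qed.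

Lemma measurable_fun_coord d1 (T1 : measurableType d1) n (f : T1 -> 'rV[R]_n) :
  (forall i, measurable_fun [set: T1] (fun x => f x ord0 i)) ->
  measurable_fun [set: T1] f.
Proof.
move=> mf; rewrite /measurable_fun => _.
pose S := [set A : set 'rV[R]_n | measurable (f @^-1` A)].
suff: (@measurable _ 'rV[R]_n) `<=` S by move=> H Y /H; rewrite setTI.
apply: smallest_sub.
  split; rewrite /S /=.
  - by rewrite preimage_set0.
  - by move=> A mA; rewrite setTD preimage_setC; exact: measurableC.
  - by move=> F mF; rewrite preimage_bigcup; exact: bigcup_measurable.
rewrite -bigcup_seq/= => A [i _ [B mB <-]].
by rewrite /S/= setTI; have := mf i measurableT B mB; rewrite setTI.
Qed.

End measurable_coordinates.

Section lebesgue_rV.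
Context {R : realType}.
Local Open Scope ereal_scope.

Definition rV_cons n (p : R * 'rV[R]_n) : 'rV[R]_n.+1 :=
  row_mx (p.1%:M : 'rV_1) p.2.

(* Cavalieri's principle: the iterated product of the measure on R. *)
Fixpoint lebesgue_rV (n : nat) : set 'rV[R]_n -> \bar R :=
  match n with
  | 0 => fun A => \d_(0%R : 'rV[R]_0) A
  | m.+1 => fun A =>
      \int[lebesgue_measure]_x lebesgue_rV [set y | A (rV_cons (x, y))]
  end.

Definition rV_uncons n (x : 'rV[R]_n.+1) : measurableTypeR R * 'rV[R]_n :=
  (x ord0 ord0, rsubmx (x : 'rV_(1 + n))).

Lemma rV_consK n : cancel (@rV_cons n) (@rV_uncons n).
Proof.
move=> [a y]; rewrite /rV_uncons /rV_cons /=; congr (_, _); last exact: row_mxKr.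
have -> : (ord0 : 'I_n.+1) = lshift n (ord0 : 'I_1) by exact: val_inj.
by rewrite (@row_mxEl R 1 1 n) mxE eqxx.
Qed.

Lemma measurable_rV_cons n : measurable_fun [set: measurableTypeR R * 'rV[R]_n]
  (@rV_cons n : measurableTypeR R * 'rV[R]_n -> 'rV[R]_n.+1).
Proof.
apply: measurable_fun_coord => i; rewrite /rV_cons.
case: (@split_ordP 1 n i) => j ->.
- under eq_fun do rewrite (@row_mxEl R 1 1 n) mxE !ord1 eqxx mulr1n.
  exact: measurable_fst.
- under eq_fun do rewrite (@row_mxEr R 1 1 n).
  by apply: (measurableT_comp (measurable_coord j)).
Qed.

Lemma measurable_rV_uncons n : measurable_fun [set: 'rV[R]_n.+1] (@rV_uncons n).
Proof.
apply/measurable_fun_pairP; split; first exact: measurable_coord.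
apply: measurable_fun_coord => i.
rewrite /comp/=; under eq_fun do rewrite mxE.
exact: measurable_coord.
Qed.

Section measure_rV_cons.
Variables (n : nat) (l : {sigma_finite_measure set (measurableTypeR R) -> \bar R}).
Variable m : {sigma_finite_measure set 'rV[R]_n -> \bar R}.

Let p : {measure set _ -> \bar R} := l \x m.

Let cons : (measurableTypeR R * 'rV[R]_n)%type -> 'rV[R]_n.+1 := @rV_cons n.

Definition measure_rV_cons : set 'rV[R]_n.+1 -> \bar R := fun A =>
  \int[l]_x m [set y | A (rV_cons (x, y))].

Let pushforwardE :
  measure_rV_cons = measure_function_pushforward__canonical__measure_function_Measure
    p (@measurable_rV_cons n : measurable_fun setT cons).
Proof.
apply/funext => A; apply: eq_integral => x _ /=; congr (m _).
by apply/seteqP; split => y; rewrite /xsection/= inE.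
Qed.

Let cons0 : measure_rV_cons set0 = 0.
Proof. by rewrite pushforwardE measure0. Qed.

Let cons_ge0 A : 0 <= measure_rV_cons A.
Proof. by rewrite pushforwardE. Qed.

Let cons_sigma_additive : semi_sigma_additive measure_rV_cons.
Proof. by rewrite pushforwardE; exact: measure_semi_sigma_additive. Qed.

HB.instance Definition _ := isMeasure.Build _ _ _ measure_rV_cons
  cons0 cons_ge0 cons_sigma_additive.

Let cons_sigma_finite : sigma_finite setT measure_rV_cons.
Proof.
rewrite pushforwardE.
have /sigma_finiteP[F [TF ndF Foo]] := sigma_finiteT l.
have /sigma_finiteP[G [TG ndG Goo]] := sigma_finiteT m.
exists (fun i => @rV_uncons n @^-1` (F i `*` G i)).
  rewrite -preimage_bigcup (_ : \bigcup_i _ = setT) ?preimage_setT//.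
  apply/seteqP; split=> // -[x y] _.
  have [i _ Fx] : (\bigcup_i F i) x by rewrite -TF.
  have [j _ Gy] : (\bigcup_j G j) y by rewrite -TG.
  exists (maxn i j) => //; split.
  - by move: x Fx; exact/subsetPset/ndF/leq_maxl.
  - by move: y Gy; exact/subsetPset/ndG/leq_maxr.
move=> i; have [mF Fi] := Foo i; have [mG Gi] := Goo i.
have mFG : measurable (F i `*` G i) by exact: measurableX.
split; first by rewrite -[X in measurable X]setTI; exact: measurable_rV_uncons.
rewrite /= /pushforward [X in p X](_ : _ = F i `*` G i).
  by rewrite /p/= product_measure1E// lte_mul_pinfty// ge0_fin_numE.
by apply/seteqP; split => x; rewrite /preimage /mkset /cons rV_consK.
Qed.

HB.instance Definition _ := Measure_isSigmaFinite.Build _ _ _ measure_rV_cons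
  cons_sigma_finite.

End measure_rV_cons.

Lemma lebesgue_rV_spec n :
  exists m : {sigma_finite_measure set 'rV[R]_n -> \bar R}, @lebesgue_rV n = m.
Proof.
elim: n => [|n [m IH]]; first by exists (@dirac _ 'rV[R]_0 0%R R).
exists (measure_rV_cons lebesgue_measure m).
by apply/funext => A; rewrite /= IH.
Qed.

Section instances.
Variable n : nat.

Let leb0 : @lebesgue_rV n set0 = 0.
Proof. by have [m ->] := lebesgue_rV_spec n; rewrite measure0. Qed.

Let leb_ge0 A : 0 <= @lebesgue_rV n A.
Proof. by have [m ->] := lebesgue_rV_spec n. Qed.

Let leb_sigma_additive : semi_sigma_additive (@lebesgue_rV n).
Proof.
by have [m ->] := lebesgue_rV_spec n; exact: measure_semi_sigma_additive.
Qed.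

HB.instance Definition _ := isMeasure.Build _ _ _ (@lebesgue_rV n)
  leb0 leb_ge0 leb_sigma_additive.

Let leb_sigma_finite : sigma_finite setT (@lebesgue_rV n).
Proof. by have [m ->] := lebesgue_rV_spec n; exact: sigma_finiteT. Qed.

HB.instance Definition _ := Measure_isSigmaFinite.Build _ _ _ (@lebesgue_rV n)
  leb_sigma_finite.

End instances.

End lebesgue_rV.
Arguments lebesgue_rV {R} n _.

Section domains.
Context {R : realType} {d : nat}.
Implicit Types (x y v : 'rV[R]_d) (U Omega : set 'rV[R]_d) (f g : 'rV[R]_d -> R).

Definition partial (i : 'I_d) f : 'rV[R]_d -> R :=
  fun x => 'D_(delta_mx ord0 i) f x.

Definition grad f : 'rV[R]_d -> 'rV[R]_d := fun x => \row_i partial i f x.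

(* C^oo on the open set U: all iterated partial derivatives exist and are
   continuous on U. *)
Definition smooth_on U f := forall (s : seq 'I_d) x, U x ->
  {for x, continuous (foldr partial f s)} /\
  forall i, derivable (foldr partial f s) x (delta_mx ord0 i).

(* Near every boundary point, Omega is a strict sublevel set of a smooth function
   with nonvanishing gradient. *)
Definition smooth_boundary Omega := forall x, (closure Omega `\` Omega°) x ->
  exists U (rho : 'rV[R]_d -> R),
    [/\ open U, U x, smooth_on U rho,
        forall y, U y -> grad rho y <> 0 &
        forall y, U y -> (Omega y <-> rho y < 0)].

Definition smooth_bounded_domain Omega :=
  [/\ open Omega, connected Omega, Omega !=set0, bounded_set Omega &
      smooth_boundary Omega].

(* The norm of the library on 'rV[R]_d is the sup norm. *)
Definition enorm x : R := Num.sqrt (\sum_i x ord0 i ^+ 2).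

End domains.

(* An element of H^1 is represented by a pair: a function and a representative of
   its weak gradient. *)
Notation H1pair R d :=
  (('rV[R]_d -> R) * ('rV[R]_d -> 'rV[R]_d))%type (only parsing).

Section sobolev.
Context {R : realType} {d : nat}.
Variable Omega : set 'rV[R]_d.
Implicit Types (f g phi : 'rV[R]_d -> R) (F G : 'rV[R]_d -> 'rV[R]_d).
Implicit Types (u w : H1pair R d).

Definition L2 : set ('rV[R]_d -> R) := [set f : 'rV[R]_d -> R |
  measurable_fun Omega f /\
  (lebesgue_rV d).-integrable Omega (fun x => (f x ^+ 2)%:E)].

Definition ip f g : R := \int[lebesgue_rV d]_(x in Omega) (f x * g x).

Definition vip F G : R :=
  \int[lebesgue_rV d]_(x in Omega) (\sum_i F x ord0 i * G x ord0 i).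

Definition nrm f : R := Num.sqrt (ip f f).

Definition vnrm F : R := Num.sqrt (vip F F).

Definition Linfty_norm f : \bar R :=
  ess_sup (lebesgue_rV d) (fun x => `|(f \_ Omega) x|%:E).

(* C_c^oo(Omega), as functions on the whole space *)
Definition test_function : set ('rV[R]_d -> R) := [set phi : 'rV[R]_d -> R |
  smooth_on setT phi /\
  exists K, [/\ compact K, K `<=` Omega & forall x, ~ K x -> phi x = 0]].

Definition weak_gradient f F := forall phi i, test_function phi ->
  ip f (partial i phi) = - ip (fun x => F x ord0 i) phi.

Definition H1 : set (H1pair R d) := [set u : H1pair R d |
  [/\ L2 u.1, forall i, L2 (fun x => u.2 x ord0 i) & weak_gradient u.1 u.2]].

Definition H1norm u : R := Num.sqrt (nrm u.1 ^+ 2 + vnrm u.2 ^+ 2).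

Definition H1eq u w :=
  {ae lebesgue_rV d, forall x, Omega x -> u.1 x = w.1 x /\ u.2 x = w.2 x}.

(* closure of C_c^oo(Omega) in H^1(Omega) *)
Definition H10 : set (H1pair R d) := [set u : H1pair R d | H1 u /\
  forall e : R, 0 < e -> exists2 phi, test_function phi &
    H1norm (u - (phi, grad phi)) < e].

(* D i is the weak gradient of the i-th component of the gradient of u. *)
Definition weak_hessian u (D : 'I_d -> 'rV[R]_d -> 'rV[R]_d) :=
  H1 u /\ forall i, H1 (fun x => u.2 x ord0 i, D i).

Definition H2_H10 : set (H1pair R d) := [set u : H1pair R d | H10 u /\
  exists D, weak_hessian u D].

Definition H2norm u (D : 'I_d -> 'rV[R]_d -> 'rV[R]_d) : R :=
  Num.sqrt (nrm u.1 ^+ 2 + vnrm u.2 ^+ 2 + \sum_i vnrm (D i) ^+ 2).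

(* [w t] is the derivative of the curve [u] at every t in [0, T], one-sided at the
   endpoints, in the norm of H^1.  For curves in a finite element space, which is
   finite-dimensional, the choice of the norm is immaterial. *)
Definition time_derivative (T : R) (u w : R -> H1pair R d) := forall t : R,
  0 <= t <= T ->
  H1norm ((s - t)^-1 *: (u s - u t) - w t)
    @[s --> within [set s : R | 0 <= s <= T] t^'] --> (0 : R).

End sobolev.

Section finite_elements.
Context {R : realType} {d : nat}.

(* A d-simplex, given by the matrix whose rows are its d + 1 vertices; a mesh is
   the list of its simplices. *)
Definition simplex := 'M[R]_(d.+1, d).

Definition mesh := seq simplex.

Definition barycentric (l : 'rV[R]_d.+1) :=
  (forall i, 0 <= l ord0 i) /\ \sum_i l ord0 i = 1.

Definition hull (K : simplex) : set 'rV[R]_d :=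
  [set x | exists2 l, barycentric l & x = l *m K].

(* the convex hull of the vertices common to K and K' *)
Definition common_face (K K' : simplex) : set 'rV[R]_d :=
  [set x | exists l, [/\ barycentric l, x = l *m K &
    forall i, l ord0 i != 0 -> exists j, row j K' = row i K]].

Definition diam (K : simplex) : R :=
  \big[Num.max/0]_(i < d.+1) \big[Num.max/0]_(j < d.+1)
    enorm (row i K - row j K).

Definition mesh_size (M : mesh) : R := \big[Num.max/0]_(K <- M) diam K.

Definition conforming (M : mesh) := forall K K', K \in M -> K' \in M ->
  hull K `&` hull K' = common_face K K'.

Definition cover (M : mesh) : set 'rV[R]_d :=
  [set x | exists2 K, K \in M & hull K x].

(* [Th h], for h in the set Hs of mesh sizes, is a conforming partition of Omega
   into simplices, of mesh size h.  As the boundary of Omega is curved when d > 1,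
   the simplices lie in the closure of Omega and fill Omega up to a boundary layer
   of width O(h^2).  Quasi-uniformity: every simplex contains a ball of radius
   kappa h (hence is nondegenerate), with kappa independent of h. *)
Record quasi_uniform_family (Omega : set 'rV[R]_d) (Hs : set R)
    (Th : R -> mesh) : Prop := {
  mesh_size_gt0 : forall h, Hs h -> 0 < h ;
  mesh_sizeE : forall h, Hs h -> mesh_size (Th h) = h ;
  mesh_conforming : forall h, Hs h -> conforming (Th h) ;
  mesh_sub : forall h, Hs h -> cover (Th h) `<=` closure Omega ;
  mesh_cover : exists2 C : R, 0 < C & forall h x, Hs h -> Omega x ->
    ~ cover (Th h) x ->
    exists2 y, (closure Omega `\` Omega°) y & enorm (x - y) <= C * h ^+ 2 ;
  mesh_quasi_uniform : exists2 kappa : R, 0 < kappa & forall h K, Hs h ->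
    K \in Th h -> exists x, [set y | enorm (y - x) <= kappa * h] `<=` hull K }.

(* Functions of H^1_0 that are continuous, affine on every simplex, and extended by
   zero to the boundary layer. *)
Definition fe_space (Omega : set 'rV[R]_d) (M : mesh) : set (H1pair R d) :=
  [set u : H1pair R d | [/\ H10 Omega u,
    {within closure Omega, continuous u.1},
    forall K, K \in M -> exists a (b : 'rV[R]_d), forall x, hull K x ->
      u.1 x = a + \sum_i b ord0 i * x ord0 i &
    forall x, closure Omega x -> ~ cover M x -> u.1 x = 0]].

Definition elliptic_projection (Omega : set 'rV[R]_d) (S : set (H1pair R d))
    (P : H1pair R d -> H1pair R d) := forall g, H10 Omega g -> S (P g) /\
  forall chi, S chi -> vip Omega (g - P g).2 chi.2 = 0.

Definition projection_error_estimate (Omega : set 'rV[R]_d) (Hs : set R)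
    (P : R -> H1pair R d -> H1pair R d) :=
  exists2 Q : R, 0 < Q & forall h g D, Hs h -> H10 Omega g ->
    weak_hessian Omega g D ->
    nrm Omega (g - P h g).1 + h * vnrm Omega (g - P h g).2
      <= Q * h ^+ 2 * H2norm Omega g D.

End finite_elements.
Arguments mesh R d : clear implicits.

Section scheme.
Context {R : realType} {d : nat}.
Variables (Omega : set 'rV[R]_d) (f : R -> R) (beta gamma T : R).
Implicit Types (S : set (H1pair R d)) (u v ut vt : R -> H1pair R d).

Local Notation "<< a , b >>" := (ip Omega a b).
Local Notation "<<| a , b |>>" := (vip Omega a b).

Definition equation_u S u v ut := forall t chi, 0 <= t <= T -> S chi ->
  beta^-1 * << (ut t).1, chi.1 >> + <<| (u t).2, chi.2 |>>
    - 2 * <<| (v t).2, (u t).2 |>> * << (v t).1, chi.1 >>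
  = << f \o (u t).1, chi.1 >>
    - 2 * << (v t).1, f \o (u t).1 >> * << (v t).1, chi.1 >>.

Definition equation_v S u v vt := forall t chi, 0 <= t <= T -> S chi ->
  gamma^-1 * << (vt t).1, chi.1 >> + <<| (v t).2, chi.2 |>>
    - <<| (v t).2, (v t).2 |>> * << (v t).1, chi.1 >>
  = << (derive1 f \o (u t).1) \* (v t).1, chi.1 >>
    - << (v t).1, (derive1 f \o (u t).1) \* (v t).1 >> * << (v t).1, chi.1 >>.

Definition semidiscrete_solution S (P : H1pair R d -> H1pair R d)
    (u0 v0 : H1pair R d) u v :=
  exists ut vt,
  [/\ forall t, 0 <= t <= T -> [/\ S (u t), S (v t), S (ut t) & S (vt t)],
      time_derivative Omega T u ut /\ time_derivative Omega T v vt,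
      equation_u S u v ut /\ equation_v S u v vt,
      H1eq Omega (u 0) (P u0) &
      H1eq Omega (v 0) ((nrm Omega (P v0).1)^-1 *: P v0)].

Definition assumptionA := (forall z, derivable f z 1) /\
  forall r : R, 0 < r -> exists2 L : R, 0 < L &
    forall z1 z2, - r <= z1 <= r -> - r <= z2 <= r ->
      `|f z1 - f z2| + `|derive1 f z1 - derive1 f z2| <= L * `|z1 - z2|.

(* the norm of L^oo(0, T; L^oo(Omega)) *)
Definition Linfty_Linfty_norm (u : R -> H1pair R d) : \bar R :=
  ess_sup lebesgue_measure
    ((fun t => Linfty_norm Omega (u t).1) \_ [set t : R | 0 < t < T]).

Definition assumptionB (Hs : set R) (Th : R -> mesh R d)
    (P : R -> H1pair R d -> H1pair R d) (u0 v0 : H1pair R d) (h0 C0 : R) :=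
  forall h u v, Hs h -> 0 < h < h0 ->
    semidiscrete_solution (fe_space Omega (Th h)) (P h) u0 v0 u v ->
    (Linfty_Linfty_norm u <= C0%:E)%E.

End scheme.

(* Main.v *)
Require Import Defs.
From mathcomp Require Import all_boot all_order all_algebra.
From mathcomp Require Import all_classical all_reals all_analysis.
From mathcomp Require Import measurable_realfun ess_sup_inf ring lra.

(** The bound is an energy estimate carried by two cancellations.

    Testing the second equation with [v] gives, for [y = ||v||^2],
    [y' = 2 gamma (1 - y) ((f'(u) v, v) - ||grad v||^2)].  The initial director has
    unit norm, so [1 - y] solves a linear homogeneous equation with zero initial
    value: the director keeps unit norm ([director_unit]) and is orthogonal to [vt].

    Testing the second equation with [vt], the two cubic terms carry the factor
    [(v, vt) = 0] and vanish.  What remains is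
    [gamma^-1 ||vt||^2 + (1/2) (||grad v||^2)' = (f'(u) v, vt) <= M ||vt||],
    and Young's inequality absorbs [||vt||] ([grad_v_bound]).

    Testing the first equation with [ut], the term [2 (grad v, grad u) (v, ut)] is at
    most [2 K ||grad u|| ||ut||], where [K] bounds [||grad v||].  Young's inequality
    absorbs [||ut||] and leaves [(||grad u||^2)' <= a ||grad u||^2 + b], to which
    Gronwall's lemma applies ([grad_u_bound]).

    None of the constants sees the mesh.  The bounds [|f|, |f'| <= M] only need
    [|u| <= C0], and the initial energies are controlled because an elliptic
    projection does not increase the norm of the gradient, while [||P v0|| >= 1/2].

    Two points of analysis are involved.  The bound on [u] is given for almost
    every time, whereas the energy identities hold at every time; as [u] is
    continuous in time with values in [L2] and [{g | |g| <= C0 a.e.}] is closed in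
    [L2], the bound holds at every time ([Linfty_bound_everywhere]).  And the time
    derivative of a quadratic form along a curve is computed once, for an abstract
    semi-inner product ([sip_curve_derivative]), then used for both [||.||^2] and
    [||grad .||^2]. *)
Import Order.TTheory GRing.Theory Num.Theory.
Import numFieldNormedType.Exports.
Local Open Scope classical_set_scope.
Local Open Scope ring_scope.

Set Implicit Arguments.
Unset Strict Implicit.
Unset Printing Implicit Defensive.

(** * Open sets and bounded sets for the Lebesgue measure on row vectors *)

Section lebesgue_domain.
Context {R : realType}.

Let box d (q : 'rV[rat]_d * rat) : set 'rV[R]_d :=
  \bigcap_(i in [set: 'I_d])
    (fun x : 'rV[R]_d => x ord0 i) @^-1`
      `]ratr (q.1 ord0 i) - ratr q.2, ratr (q.1 ord0 i) + ratr q.2[.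

Let measurable_box d (q : 'rV[rat]_d * rat) : measurable (box q).
Proof.
apply: fin_bigcap_measurable => [|i _]; first exact: finite_finset.
rewrite -[X in measurable X]setTI.
by apply: measurable_coord => //; exact: measurable_itv.
Qed.

(** The sigma-algebra is generated by the coordinates, so that an open set has to be
    written as a countable union of boxes: the rational ones that it contains. *)
Lemma open_measurable_rV d (U : set 'rV[R]_d) : open U -> measurable U.
Proof.
move=> oU.
have -> : U = \bigcup_(q : 'rV[rat]_d * rat)
    (if `[< box q `<=` U >] then box q else set0).
  apply/seteqP; split => [x Ux|x [q _]]; last first.
    by case: ifPn => // /asboolP; exact.
  have /nbhs_ballP[e /= e0 xeU] : nbhs x U by exact: open_nbhs_nbhs.
  have [r] := @rat_in_itvoo R 0 (e / 2) ltac:(lra).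
  rewrite in_itv /= => /andP[r0 re].
  have /choice[q qP] : forall i : 'I_d, exists q : rat,
      ratr q \in `]x ord0 i - ratr r, x ord0 i + ratr r[.
    by move=> i; apply: rat_in_itvoo; lra.
  exists (\row_i q i, r) => //; rewrite ifT.
    move=> i _ /=; rewrite mxE in_itv /=.
    by have := qP i; rewrite in_itv /= => /andP[? ?]; apply/andP; split; lra.
  apply/asboolP => y yq; apply: xeU; split => // j i; rewrite ord1.
  have := yq i Logic.I; have := qP i; rewrite /= mxE !in_itv /=.
  move=> /andP[? ?] /andP[? ?].
  by rewrite /ball /= ltr_norml; apply/andP; split; lra.
apply: countable_bigcupT_measurable => // q.
by case: ifP => _; [exact: measurable_box|exact: measurable0].
Qed.

Let cube d (M : R) : set 'rV[R]_d := [set x | forall i, x ord0 i \in `[- M, M]].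

Let measurable_cube d M : measurable (@cube d M).
Proof.
have -> : @cube d M = \bigcap_(i in [set: 'I_d])
    (fun x : 'rV[R]_d => x ord0 i) @^-1` `[- M, M].
  by apply/seteqP; split => x Hx; [move=> i _|move=> i]; exact: Hx.
apply: fin_bigcap_measurable => [|i _]; first exact: finite_finset.
rewrite -[X in measurable X]setTI.
by apply: measurable_coord => //; exact: measurable_itv.
Qed.

(** By Cavalieri's principle, the slice of a cube is a smaller cube or is empty. *)
Let lebesgue_cube_fin d M : (lebesgue_rV d (@cube d M) < +oo)%E.
Proof.
elim: d => [|d IH] /=; first by rewrite diracE ltry.
have -> : (\int[lebesgue_measure]_x
     lebesgue_rV d [set y | @cube d.+1 M (rV_cons (x, y))] =
   \int[lebesgue_measure]_x (lebesgue_rV d (@cube d M) * (\1_(`[- M, M]) x)%:E))%E.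
  apply: eq_integral => x _; rewrite indicE.
  have [xM|xM] := boolP (x \in _).
    rewrite mule1; congr lebesgue_rV; apply/seteqP; split => y /= Hy i.
      have := Hy (rshift 1 i); rewrite /rV_cons /=.
      by rewrite (@row_mxEr R 1 1 d).
    rewrite /rV_cons; case: (@split_ordP 1 d i) => j ->.
      rewrite (@row_mxEl R 1 1 d) mxE !ord1 eqxx mulr1n.
      by move: xM; rewrite inE.
    by rewrite (@row_mxEr R 1 1 d).
  rewrite mule0 -[RHS](@measure0 _ _ _ (lebesgue_rV d)).
  congr lebesgue_rV; apply/seteqP; split => y //= Hy.
  move/negP: xM; apply; rewrite inE /=.
  have := Hy (lshift d (ord0 : 'I_1)).
  by rewrite /rV_cons (@row_mxEl R 1 1 d) mxE eqxx mulr1n.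
rewrite ge0_integralZl//.
- rewrite integral_indic// setIT.
  have itv_fin : (lebesgue_measure (`[(- M)%R, M] : set R) < +oo)%E.
    by rewrite lebesgue_measure_itv /=; case: ifP => _; rewrite ltry.
  by rewrite lte_mul_pinfty// ge0_fin_numE.
- by apply/measurable_EFinP; exact: measurable_indic.
Qed.

(** This makes the bounded functions on a bounded domain square-integrable, in
    particular [f(u)]. *)
Lemma lebesgue_rV_bounded d (A : set 'rV[R]_d) :
  measurable A -> bounded_set A -> (lebesgue_rV d A < +oo)%E.
Proof.
move=> mA [M [_ /(_ (M + 1)) AM]].
apply: le_lt_trans (lebesgue_cube_fin d (M + 1)).
apply: le_measure; rewrite ?inE; [exact: mA|exact: measurable_cube|].
move=> x Ax i; rewrite in_itv /= -ler_norml.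
apply: le_trans (AM _ x Ax); last by lra.
by rewrite [leRHS]mx_normrE; exact: (le_bigmax _ (fun ij => `|x ij.1 ij.2|) (ord0, i)).
Qed.

End lebesgue_domain.

(** * Semi-inner products and the derivative of a quadratic form along a curve *)

Section semi_inner_product.
Context {R : realType} {V : lmodType R}.

(** The forms of interest are integrals, which are bilinear only on the
    square-integrable functions: linearity is asked on a submodule [S], inside an
    ambient module of arbitrary functions.  They are also degenerate, since functions
    are not identified almost everywhere. *)
Record semi_inner_product (S : set V) (B : V -> V -> R) : Prop := {
  sip_closed : forall a u v, S u -> S v -> S (a *: u + v) ;
  sip_linear : forall a u v w, S u -> S v -> S w ->
    B (a *: u + v) w = a * B u w + B v w ;
  sip_sym : forall u v, B u v = B v u ;
  sip_ge0 : forall u, 0 <= B u u }.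

Variables (S : set V) (B : V -> V -> R).
Hypothesis sipB : semi_inner_product S B.

Lemma sip_closedD u v : S u -> S v -> S (u + v).
Proof. by move=> Su Sv; rewrite -[u]scale1r; exact: (sip_closed sipB). Qed.

Lemma sip_closedB u v : S u -> S v -> S (u - v).
Proof. by move=> Su Sv; rewrite addrC -scaleN1r; exact: (sip_closed sipB). Qed.

Lemma sip_closedZ a u : S u -> S (a *: u).
Proof.
move=> Su; rewrite -[_ *: _]addr0 -(subrr u) addrA.
by apply: sip_closedB => //; exact: (sip_closed sipB).
Qed.

Lemma sip_addl u v w : S u -> S v -> S w -> B (u + v) w = B u w + B v w.
Proof. by move=> *; rewrite -[u in LHS]scale1r (sip_linear sipB)// mul1r. Qed.

Lemma sip_scalel a u w : S u -> S w -> B (a *: u) w = a * B u w.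
Proof.
move=> Su Sw.
have Sau : S (a *: u) by exact: sip_closedZ.
have := sip_linear sipB (a - 1) Su Su Sw.
by rewrite scalerBl scale1r subrK => ->; ring.
Qed.

Lemma sip_sqr a u v : S u -> S v ->
  B (a *: u + v) (a *: u + v) = a ^+ 2 * B u u + 2 * a * B u v + B v v.
Proof.
move=> Su Sv; have Sw : S (a *: u + v) by exact: (sip_closed sipB).
rewrite (sip_linear sipB)// (sip_sym sipB u) (sip_sym sipB v) !(sip_linear sipB)//.
by rewrite (sip_sym sipB v u); ring.
Qed.

Lemma sip_cauchy_schwarz u v : S u -> S v ->
  `|B u v| <= Num.sqrt (B u u) * Num.sqrt (B v v).
Proof.
move=> Su Sv; rewrite -sqrtrM ?(sip_ge0 sipB)// -sqrtr_sqr; apply: ler_wsqrtr.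
(* A polynomial in [a] that takes no negative value has a nonpositive discriminant,
   which is the claim. *)
have disc a : 0 <= a ^+ 2 * B u u + 2 * a * B u v + B v v.
  by rewrite -sip_sqr//; exact: (sip_ge0 sipB).
have u0 := sip_ge0 sipB u; have v0 := sip_ge0 sipB v.
have [uu0|uu0] := eqVneq (B u u) 0.
  have [->|uv0] := eqVneq (B u v) 0; first by rewrite expr0n mulr_ge0.
  (* An affine function that is bounded below is constant. *)
  have := disc (- (B v v + 1) / (2 * B u v)).
  have -> : 2 * (- (B v v + 1) / (2 * B u v)) * B u v = - (B v v + 1) by field.
  by rewrite uu0 mulr0; lra.
have {}uu0 : 0 < B u u by rewrite lt_neqAle eq_sym uu0.
(* The polynomial is evaluated at its minimizer. *)
have := disc (- B u v / B u u).
have -> : (- B u v / B u u) ^+ 2 * B u u + 2 * (- B u v / B u u) * B u v + B v v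
  = (B u u * B v v - B u v ^+ 2) / B u u by field; exact: lt0r_neq0.
by rewrite pmulr_lge0 ?invr_gt0// subr_ge0.
Qed.

Lemma sip_triangle u v : S u -> S v ->
  Num.sqrt (B (u + v) (u + v)) <= Num.sqrt (B u u) + Num.sqrt (B v v).
Proof.
move=> Su Sv; rewrite -[leRHS]ger0_norm ?addr_ge0 ?sqrtr_ge0//.
rewrite -sqrtr_sqr; apply: ler_wsqrtr.
have := @sip_sqr 1 u v Su Sv; rewrite scale1r => ->.
rewrite sqrrD !sqr_sqrtr ?(sip_ge0 sipB)// expr1n mul1r mulr1 lerD2r lerD2l.
rewrite mulr_natl lerMn2r /=.
exact: le_trans (ler_norm _) (sip_cauchy_schwarz Su Sv).
Qed.

Lemma sip_pythagoras u p : S u -> S p -> B (u - p) p = 0 -> B p p <= B u u.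
Proof.
move=> Su Sp up0; have Sd : S (u - p) by exact: sip_closedB.
have := @sip_sqr 1 (u - p) p Sd Sp; rewrite scale1r subrK up0 => ->.
by rewrite mulr0 addr0 expr1n mul1r lerDr; exact: (sip_ge0 sipB).
Qed.

Section curve.
Variables (D : set R) (c : R -> V) (w : V) (t : R).
Hypotheses (Dt : D t) (Sc : forall s, D s -> S (c s)) (Sw : S w).

Let n u := Num.sqrt (B u u).

(** The defect of the difference quotient at [s] with respect to the derivative. *)
Let e s := (s - t)^-1 *: (c s - c t) - w.

Hypothesis cw : n (e s) @[s --> within D t^'] --> (0 : R).

Let near_in : \forall s \near within D t^', D s /\ s != t.
Proof.
change (\forall s \near t^', D s -> D s /\ s != t); near=> s => Ds.
split => //; near: s.
exact: nbhs_dnbhs_neq.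
Unshelve. all: by end_near. Qed.

Let dist0 : `|s - t| @[s --> within D t^'] --> (0 : R).
Proof.
have id0 : `|s - t| @[s --> t] --> (0 : R).
  rewrite -[X in _ --> X](normr0 R) -(subrr t).
  by apply: cvg_norm; apply: cvgB; [exact: cvg_id|exact: cvg_cst].
by apply: cvg_within_filter; apply: cvg_within_filter.
Qed.

Let in_e s : D s -> S (e s).
Proof.
move=> Ds; apply: sip_closedB => //; apply: sip_closedZ.
by apply: sip_closedB; apply: Sc.
Qed.

Let increment s : s != t -> c s - c t = (s - t) *: (w + e s).
Proof.
move=> st; rewrite /e addrCA subrr addr0 scalerA divff ?scale1r//.
by rewrite subr_eq0.
Qed.

Let bound_cvg0 : `|s - t| * (n w + n (e s)) @[s --> within D t^'] --> (0 : R).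
Proof.
rewrite -(mul0r (n w + 0)); apply: cvgM => //.
by apply: cvgD => //; exact: cvg_cst.
Qed.

Lemma sip_curve_increment : n (c s - c t) @[s --> within D t^'] --> (0 : R).
Proof.
apply: (squeeze_cvgr _ (cvg_cst 0) bound_cvg0).
near=> s.
have [Ds st] : D s /\ s != t by near: s.
rewrite sqrtr_ge0 increment//= /n.
have Swe : S (w + e s) by apply: sip_closedD => //; exact: in_e.
rewrite sip_scalel ?(sip_sym sipB (w + _)) ?sip_scalel//; last exact: sip_closedZ.
rewrite mulrA -expr2 sqrtrM ?sqr_ge0// sqrtr_sqr.
by rewrite ler_wpM2l// sip_triangle//; exact: in_e.
Unshelve. all: by end_near. Qed.

(** With [c s = c t + (s - t) (w + e s)], expanding the square leaves the error
    [2 B(c t, e s) + (s - t) B(w + e s, w + e s)] in the difference quotient, which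
    Cauchy-Schwarz and the triangle inequality send to zero. *)
Lemma sip_curve_derivative :
  (B (c s) (c s) - B (c t) (c t)) / (s - t) @[s --> within D t^']
    --> 2 * B (c t) w.
Proof.
apply/subr_cvg0.
have bnd : 2 * (n (c t) * n (e s)) +
    (n w + n (e s)) * (`|s - t| * (n w + n (e s))) @[s --> within D t^'] --> (0 : R).
  rewrite -[X in _ --> X](_ : 2 * (n (c t) * 0) + (n w + 0) * 0 = 0); last by ring.
  apply: cvgD; first by apply: cvgM; [exact: cvg_cst|apply: cvgM => //; exact: cvg_cst].
  by apply: cvgM => //; apply: cvgD => //; exact: cvg_cst.
apply/norm_cvg0P; apply: (squeeze_cvgr _ (cvg_cst 0) bnd).
near=> s.
have [Ds st] : D s /\ s != t by near: s.
rewrite normr_ge0/=.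
have Se := in_e Ds; have Sct := Sc Dt.
have Swe : S (w + e s) by apply: sip_closedD.
have -> : (B (c s) (c s) - B (c t) (c t)) / (s - t) - 2 * B (c t) w =
    2 * B (c t) (e s) + (s - t) * B (w + e s) (w + e s).
  rewrite -[c s](subrK (c t)) increment// sip_sqr//.
  rewrite (sip_addl Sw Se Sct) (sip_sym sipB w (c t)) (sip_sym sipB (e s) (c t)).
  field.
  by rewrite subr_eq0.
apply: le_trans (ler_normD _ _) _; apply: lerD.
  by rewrite normrM ger0_norm// ler_wpM2l// sip_cauchy_schwarz.
rewrite normrM (ger0_norm (sip_ge0 sipB _)) mulrCA ler_wpM2l//.
rewrite -[leLHS]sqr_sqrtr ?(sip_ge0 sipB)// -expr2.
rewrite ler_sqr ?nnegrE ?sqrtr_ge0 ?addr_ge0 ?sqrtr_ge0//.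
exact: sip_triangle.
Unshelve. all: by end_near. Qed.

End curve.
End semi_inner_product.

(** * A Gronwall lemma on a closed interval *)

Section gronwall.
Context {R : realType}.
Variable T : R.

(** The derivative is one-sided at both endpoints, as for the curves that solve the
    scheme. *)
Definition derivative_on (phi g : R -> R) := forall t, 0 <= t <= T ->
  (phi s - phi t) / (s - t)
    @[s --> within [set s : R | 0 <= s <= T] t^'] --> g t.

Variables phi g : R -> R.
Hypothesis phig : derivative_on phi g.

Lemma derivative_on_continuous : {within `[0, T], continuous phi}.
Proof.
apply/subspace_continuousP => t /=; rewrite in_itv /= => /phig.
move: t; set D := [set s : R | 0 <= s <= T] => t phit.
have dist0 : s - t @[s --> within D t^'] --> (0 : R).
  rewrite -(subrr t); apply: cvg_within_filter; apply: cvg_within_filter.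
  by apply: cvgB; [exact: cvg_id|exact: cvg_cst].
have inc0 : (phi s - phi t) / (s - t) * (s - t) @[s --> within D t^'] --> (0 : R).
  by rewrite -(mulr0 (g t)); exact: (cvgM phit dist0).
apply/cvgrPdist_lt => e e0.
have /cvgrPdist_lt/(_ e e0) := inc0.
rewrite /within /= => H.
change (\forall s \near t, s \in `[0, T] -> `|phi t - phi s| < e).
near=> s; rewrite in_itv /= => sT.
have [->|st] := eqVneq s t; first by rewrite subrr normr0.
have : `|0 - (phi s - phi t) / (s - t) * (s - t)| < e.
  by move: st sT; near: s; exact: H.
by rewrite divfK ?subr_eq0// sub0r normrN distrC.
Unshelve. all: by end_near. Qed.

Lemma derivative_on_bounded : 0 <= T ->
  exists C, forall t, 0 <= t <= T -> phi t <= C.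
Proof.
move=> T0; have [c _ phic] := EVT_max T0 derivative_on_continuous.
by exists (phi c) => t tT; apply: phic; rewrite in_itv.
Qed.

Lemma derivative_on_sqr c :
  derivative_on (fun t => (c - phi t) ^+ 2) (fun t => - 2 * (c - phi t) * g t).
Proof.
move=> t tT; have phit := phig tT.
move: phit; set D := [set s : R | 0 <= s <= T] => phit.
have phi_cvg : phi s @[s --> within D t^'] --> phi t.
  have := derivative_on_continuous; move/subspace_continuousP => /(_ t).
  rewrite /= in_itv /= => /(_ tT) phi_cvg.
  apply: cvg_trans phi_cvg => P nearP.
  have : nbhs t (fun s => s \in `[0, T] -> P (phi s)) by exact: nearP.
  change (nbhs t (fun s => s \in `[0, T] -> P (phi s)) ->
          nbhs t (fun s => s != t -> D s -> P (phi s))).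
  by apply: filterS => s DP _ Ds; apply: DP; rewrite in_itv.
have -> : (fun s => ((c - phi s) ^+ 2 - (c - phi t) ^+ 2) / (s - t)) =
    (fun s => ((phi s + phi t) - 2 * c) * ((phi s - phi t) / (s - t))).
  by apply/funext => s; ring.
have -> : - 2 * (c - phi t) * g t = (phi t + phi t - 2 * c) * g t by ring.
apply: cvgM => //; apply: cvgB; last exact: cvg_cst.
by apply: cvgD => //; exact: cvg_cst.
Qed.

Lemma derivative_on_is_derive t : 0 < t < T -> is_derive t 1 phi (g t).
Proof.
move=> /andP[t0 tT].
suff cv : h^-1 *: ((phi \o shift t) (h *: 1) - phi t) @[h --> (0 : R)^'] --> g t.
  by apply: DeriveDef; [apply/cvg_ex; exists (g t)|exact: cvg_lim cv].
apply/cvgrPdist_lt => e e0.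
have tT' : 0 <= t <= T by lra.
have /cvgrPdist_lt/(_ e e0) := phig tT'.
rewrite /within /= /dnbhs /within /= => /nbhs_ballP[r /= r0 H].
change (\forall h \near (0 : R), h != 0 ->
  `|g t - h^-1 *: (phi (h *: 1 + t) - phi t)| < e).
near=> h => h0.
have h1 : h *: 1 = h by rewrite /GRing.scale /= mulr1.
rewrite h1 /GRing.scale /= mulrC.
have : h + (t - 0) != t -> 0 <= h + (t - 0) <= T ->
    `|g t - (phi (h + (t - 0)) - phi t) / (h + (t - 0) - t)| < e.
  apply: H; rewrite /ball /= subr0 opprD addrA addrAC subrr.
  by near: h; exact: nbhsx_ballx.
rewrite subr0 addrK; apply.
  by rewrite -subr_eq0 addrK.
have : `|0 - h| < Num.min t (T - t).
  by near: h; apply: nbhsx_ballx; rewrite lt_min; lra.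
rewrite sub0r normrN lt_min => /andP[/ltr_normlP[? ?] /ltr_normlP[? ?]]; lra.
Unshelve. all: by end_near. Qed.

(** [expR (- a t) (phi t + b / a)] is nonincreasing. *)
Lemma gronwall a b : 0 < a -> 0 <= b ->
  (forall t, 0 < t < T -> g t <= a * phi t + b) -> 0 <= phi 0 ->
  forall t, 0 <= t <= T -> phi t <= expR (a * T) * (phi 0 + b / a).
Proof.
move=> a0 b0 gle phi0 t tT.
pose psi s := expR (- a * s) * (phi s + b / a).
have dpsi s : 0 < s < T ->
    is_derive s 1 psi (expR (- a * s) * (g s - a * (phi s + b / a))).
  move=> sT; have dphi := derivative_on_is_derive sT.
  have dexp : is_derive s 1 (fun s => expR (- a * s)) (expR (- a * s) * - a).
    apply: (@is_derive1_comp _ expR ( *%R (- a))).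
    by apply: is_derive_eq; rewrite /GRing.scale /= mulr1.
  apply: is_derive_eq.
  rewrite /GRing.scale /= addr0; ring.
have psi_le : psi t <= psi 0.
  apply: (@ler0_derive1_le_cc _ psi 0 T); rewrite ?in_itv /=; [..|lra|lra|lra].
  - by move=> s; rewrite in_itv /= => /dpsi [].
  - move=> s; rewrite in_itv /= => sT; rewrite derive1E.
    have [_ ->] := dpsi _ sT.
    rewrite pmulr_rle0 ?expR_gt0// mulrDr mulrCA divff ?mulr1 ?gt_eqF//.
    by have := gle _ sT; lra.
  - have cexp : {within `[0, T], continuous (fun s => expR (- a * s))}.
      apply: continuous_subspaceT => x.
      apply: continuous_comp; last exact: continuous_expR.
      exact: mulrl_continuous.
    move=> s; apply: cvgM; first exact: cexp.
    apply: cvgD; last exact: cvg_cst.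
    exact: derivative_on_continuous.
have c0 : 0 <= phi 0 + b / a by rewrite addr_ge0// divr_ge0// ltW.
have : phi t + b / a <= expR (a * t) * (phi 0 + b / a).
  move: psi_le; rewrite /psi mulr0 expR0 mul1r mulNr expRN => psi_le.
  by rewrite -ler_pdivrMl ?expR_gt0.
have : expR (a * t) * (phi 0 + b / a) <= expR (a * T) * (phi 0 + b / a).
  by rewrite ler_wpM2r// ler_expR ler_pM2l//; lra.
have : 0 <= b / a by rewrite divr_ge0// ltW.
lra.
Qed.

End gronwall.

(** * The L2 forms *)

Section L2_forms.
Context {R : realType} {d : nat}.
Variable Omega : set 'rV[R]_d.
Hypothesis mO : measurable Omega.
Implicit Types f g k : 'rV[R]_d -> R.
Local Notation mu := (lebesgue_rV d).

Lemma ipC f g : ip Omega f g = ip Omega g f.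
Proof. by apply: eq_Rintegral => x _; rewrite mulrC. Qed.

Lemma ip_ge0 f : 0 <= ip Omega f f.
Proof. by apply: Rintegral_ge0 => x _; rewrite -expr2 sqr_ge0. Qed.

(** [|f g| <= f^2 + g^2]. *)
Lemma L2_mul_integrable f g : L2 Omega f -> L2 Omega g ->
  mu.-integrable Omega (fun x => (f x * g x)%:E).
Proof.
move=> [mf f2] [mg g2].
apply: (le_integrable mO) (integrableD mO f2 g2).
  by apply/measurable_EFinP; exact: measurable_funM.
move=> x _ /=; rewrite lee_fin.
rewrite [leRHS]ger0_norm ?addr_ge0 ?sqr_ge0// ler_norml.
have := sqr_ge0 (f x + g x); have := sqr_ge0 (f x - g x).
by have := sqr_ge0 (f x); have := sqr_ge0 (g x); nra.
Qed.

Let lincombE a f g x : (a *: f + g) x = a * f x + g x.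
Proof. by []. Qed.

Lemma L2_linear_combination a f g : L2 Omega f -> L2 Omega g -> L2 Omega (a *: f + g).
Proof.
move=> Lf Lg; have [mf f2] := Lf; have [mg g2] := Lg.
have mafg : measurable_fun Omega (a *: f + g).
  by apply: measurable_funD => //; exact: measurable_funM.
split => //.
have -> : (fun x => ((a *: f + g) x ^+ 2)%:E) =
    (fun x => (a ^+ 2)%:E * (f x ^+ 2)%:E +
      ((2 * a)%:E * (f x * g x)%:E + (g x ^+ 2)%:E))%E.
  apply/funext => x; rewrite -!EFinM -!EFinD; congr EFin.
  by rewrite lincombE; ring.
apply: integrableD => //; first exact: integrableZl.
apply: integrableD => //; apply: integrableZl => //; exact: L2_mul_integrable.
Qed.

Lemma ip_semi_inner_product : semi_inner_product (L2 Omega) (ip Omega).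
Proof.
split => [a f g|a f g k Lf Lg Lk|f g|f].
- exact: L2_linear_combination.
- have If := L2_mul_integrable Lf Lk; have Ig := L2_mul_integrable Lg Lk.
  rewrite /ip -RintegralZl// -RintegralD//.
    apply: eq_Rintegral => x _.
    by rewrite lincombE; ring.
  rewrite (_ : EFin \o _ = fun x => a%:E * (f x * k x)%:E)%E; first exact: integrableZl.
  by apply/funext => x /=; rewrite EFinM.
- exact: ipC.
- exact: ip_ge0.
Qed.

Definition vL2 : set ('rV[R]_d -> 'rV[R]_d) :=
  [set F | forall i, L2 Omega (fun x => F x ord0 i)].

(** Everything about vector fields reduces to their components. *)
Lemma vip_sum_ip F G : vL2 F -> vL2 G ->
  vip Omega F G = \sum_i ip Omega (fun x => F x ord0 i) (fun x => G x ord0 i).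
Proof.
move=> LF LG; have I i := L2_mul_integrable (LF i) (LG i).
rewrite /vip /Rintegral.
under eq_integral do rewrite -sumEFin.
rewrite integral_sum// sum_fine// => i _.
exact: integrable_fin_num.
Qed.

Lemma vip_semi_inner_product : semi_inner_product vL2 (vip Omega).
Proof.
have coordE a (F G : 'rV[R]_d -> 'rV[R]_d) i : (fun x => (a *: F + G) x ord0 i) =
    a *: (fun x => F x ord0 i) + (fun x => G x ord0 i).
  by apply/funext => x; rewrite !mxE.
have closed a (F G : 'rV[R]_d -> 'rV[R]_d) : vL2 F -> vL2 G -> vL2 (a *: F + G).
  by move=> LF LG i; rewrite coordE; exact: L2_linear_combination.
split => [//|a F G K LF LG LK|F G|F].
- rewrite !vip_sum_ip//; last exact: closed.
  rewrite mulr_sumr -big_split; apply: eq_bigr => i _ /=.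
  by rewrite coordE (sip_linear ip_semi_inner_product).
- apply: eq_Rintegral => x _; apply: eq_bigr => i _; exact: mulrC.
- apply: Rintegral_ge0 => x _; apply: sumr_ge0 => i _; by rewrite -expr2 sqr_ge0.
Qed.

(** The source of every membership in [L2] for a nonlinear expression, and of every
    bound on its norm: the domination is only asked almost everywhere. *)
Lemma L2_dominated g k : measurable_fun Omega g -> L2 Omega k ->
  {ae mu, forall x, Omega x -> `|g x| <= `|k x|} ->
  L2 Omega g /\ ip Omega g g <= ip Omega k k.
Proof.
move=> mg Lk gk; have [mk k2] := Lk.
have mg2 : measurable_fun Omega (fun x => (g x ^+ 2)%:E).
  by apply/measurable_EFinP; exact: measurable_funX.
have mk2 : measurable_fun Omega (fun x => (k x ^+ 2)%:E).
  by apply/measurable_EFinP; exact: measurable_funX.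
have le_gk : (\int[mu]_(x in Omega) (g x ^+ 2)%:E <=
    \int[mu]_(x in Omega) (k x ^+ 2)%:E)%E.
  apply: ae_ge0_le_integral => //.
  - by move=> x _; rewrite lee_fin sqr_ge0.
  - by move=> x _; rewrite lee_fin sqr_ge0.
  apply: filterS gk => x gk Ox; rewrite lee_fin -[leLHS]real_normK ?num_real//.
  by rewrite -[leRHS]real_normK ?num_real// ler_sqr ?nnegrE//; exact: gk.
have fin_k : (\int[mu]_(x in Omega) (k x ^+ 2)%:E < +oo)%E.
  by apply: integrable_lty.
have Ig : mu.-integrable Omega (fun x => (g x ^+ 2)%:E).
  apply/integrableP; split => //.
  under eq_integral do rewrite gee0_abs ?lee_fin ?sqr_ge0//.
  exact: le_lt_trans fin_k.
split=> //; rewrite /ip /Rintegral.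
under eq_integral do rewrite -expr2.
under [in leRHS]eq_integral do rewrite -expr2.
by apply: fine_le => //; exact: integrable_fin_num.
Qed.

Lemma ip_ae_eq f g : measurable_fun Omega f -> L2 Omega g ->
  {ae mu, forall x, Omega x -> f x = g x} -> ip Omega f f = ip Omega g g.
Proof.
move=> mf Lg fg.
have [Lf le_fg] : L2 Omega f /\ ip Omega f f <= ip Omega g g.
  by apply: L2_dominated => //; apply: filterS fg => x fg /fg ->.
apply/eqP; rewrite eq_le le_fg /=.
have [_ ->//] : L2 Omega g /\ ip Omega g g <= ip Omega f f.
by apply: L2_dominated => //; [case: Lg|apply: filterS fg => x fg /fg ->].
Qed.

Lemma ip_eq0_ae f : L2 Omega f -> ip Omega f f = 0 ->
  {ae mu, forall x, Omega x -> f x = 0}.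
Proof.
move=> Lf f0; have [mf f2] := Lf.
have mf2 : measurable_fun Omega (fun x => (f x ^+ 2)%:E).
  by apply/measurable_EFinP; exact: measurable_funX.
have : (\int[mu]_(x in Omega) `|(f x ^+ 2)%:E| = 0)%E.
  under eq_integral do rewrite gee0_abs ?lee_fin ?sqr_ge0//.
  have fin := integrable_fin_num mO f2.
  rewrite -(fineK fin); congr EFin.
  by rewrite -[RHS]f0 /ip /Rintegral; under [in RHS]eq_integral do rewrite -expr2.
move/(ae_eq_integral_abs mu mO mf2); apply: filterS => x /[apply] /eqP.
by rewrite /cst /= eqe expf_eq0 /= => /eqP.
Qed.

End L2_forms.

(** * Superposition operators and almost everywhere bounds *)

Section reaction_terms.
Context {R : realType} {d : nat}.
Variable Omega : set 'rV[R]_d.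
Hypothesis mO : measurable Omega.
Implicit Types g k w : 'rV[R]_d -> R.
Local Notation mu := (lebesgue_rV d).

Lemma L2_cst1 : (mu Omega < +oo)%E -> L2 Omega (cst 1 : 'rV[R]_d -> R).
Proof.
move=> Ofin; split; first exact: measurable_cst.
apply/integrableP; split; first by apply/measurable_EFinP; exact: measurable_funX.
under eq_integral do rewrite /= expr1n normr1.
by rewrite integral_cst// mul1e.
Qed.

(** Covers [f'(u) v], and [f(u)] by taking for [k] the constant 1. *)
Lemma superposition_bound (phi : R -> R) (C M : R) w k :
  continuous phi -> (forall z, `|z| <= C -> `|phi z| <= M) ->
  measurable_fun Omega w -> {ae mu, forall x, Omega x -> `|w x| <= C} ->
  L2 Omega k ->
  L2 Omega ((phi \o w) \* k) /\ nrm Omega ((phi \o w) \* k) <= `|M| * nrm Omega k.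
Proof.
move=> cphi phiM mw wC Lk; have [mk _] := Lk.
have ipS := ip_semi_inner_product mO.
have mphi : measurable_fun Omega ((phi \o w) \* k).
  apply: measurable_funM => //; apply: measurableT_comp => //.
  exact: continuous_measurable_fun.
have LMk : L2 Omega (M *: k) by exact: (sip_closedZ ipS).
have dom : {ae mu, forall x, Omega x -> `|((phi \o w) \* k) x| <= `|(M *: k) x|}.
  apply: filterS wC => x wC Ox.
  rewrite /= normrM [leRHS]normrM ler_wpM2r//.
  exact: le_trans (phiM _ (wC Ox)) (ler_norm _).
have [L le_ip] := L2_dominated mO mphi LMk dom.
split => //; rewrite /nrm -sqrtr_sqr -sqrtrM ?sqr_ge0//; apply: ler_wsqrtr.
apply: le_trans le_ip _.
by rewrite (sip_scalel ipS)// ipC (sip_scalel ipS)// mulrA -expr2.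
Qed.

(** If [|k| <= C] then the excess [m] of [|g|] over [C] is at most [|k - g|], so that
    [||m|| <= ||k - g||] can be made as small as desired and [m] vanishes. *)
Lemma L2_closed_bound (C : R) g : L2 Omega g ->
  (forall e : R, 0 < e -> exists k, [/\ L2 Omega k,
    {ae mu, forall x, Omega x -> `|k x| <= C} & nrm Omega (k - g) < e]) ->
  {ae mu, forall x, Omega x -> `|g x| <= C}.
Proof.
move=> Lg approx; have [mg _] := Lg.
pose m x := Num.max (`|g x| - C) 0.
have mm : measurable_fun Omega m.
  apply: measurable_maxr; last exact: measurable_cst.
  by apply: measurable_funB; [exact: measurableT_comp|exact: measurable_cst].
have dom k : L2 Omega k -> {ae mu, forall x, Omega x -> `|k x| <= C} ->
    L2 Omega m /\ ip Omega m m <= nrm Omega (k - g) ^+ 2.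
  move=> Lk kC; rewrite sqr_sqrtr ?ip_ge0//; apply: L2_dominated => //.
    exact: (sip_closedB (ip_semi_inner_product mO)).
  apply: filterS kC => x /[apply] kC; rewrite ger0_norm ?le_max ?lexx ?orbT//.
  rewrite ge_max normr_ge0 andbT.
  have : `|g x| - `|k x| <= `|(k - g) x| by rewrite distrC; exact: lerB_dist.
  lra.
have [k1 [Lk1 k1C _]] := approx 1 ltr01.
have [Lm _] := dom _ Lk1 k1C.
have m0 : ip Omega m m = 0.
  apply/eqP; rewrite eq_le ip_ge0 andbT leNgt; apply/negP => m_gt0.
  have [k [Lk kC]] := approx (Num.sqrt (ip Omega m m)) ltac:(by rewrite sqrtr_gt0).
  have [_ le_m] := dom _ Lk kC.
  rewrite ltNge => /negP; apply.
  by rewrite -[leRHS]ger0_norm ?sqrtr_ge0// -sqrtr_sqr; exact: ler_wsqrtr.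
apply: filterS (ip_eq0_ae mO Lm m0) => x /[apply] /eqP.
rewrite /m => /eqP mx0; have : `|g x| - C <= 0 by rewrite -mx0 le_max lexx.
by rewrite subr_le0.
Qed.

End reaction_terms.

Lemma ae_itv_nonempty (R : realType) (P : R -> Prop) (a b : R) : a < b ->
  {ae lebesgue_measure, forall s, P s} -> exists2 s : R, a < s < b & P s.
Proof.
move=> ab [N [mN N0 PN]]; apply: contrapT => noP.
have sub : `]a, b[%classic `<=` N.
  move=> s; rewrite /= in_itv /= => sab; apply: PN => /= Ps.
  by apply: noP; exists s.
have : (lebesgue_measure (`]a, b[ : set R) <= lebesgue_measure N)%E.
  by apply: le_measure => //; rewrite inE.
by rewrite N0 lebesgue_measure_itv /= lte_fin ab -EFinD lee_fin subr_le0 leNgt ab.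
Qed.

(** * Curves that are differentiable in H1 *)

Section curves.
Context {R : realType} {d : nat}.
Variables (Omega : set 'rV[R]_d) (T : R) (u ut : R -> H1pair R d).
Hypothesis mO : measurable Omega.
Hypothesis H1u : forall t, 0 <= t <= T -> H1 Omega (u t) /\ H1 Omega (ut t).
Hypothesis dut : time_derivative Omega T u ut.
Local Notation mu := (lebesgue_rV d).
Local Notation D := [set s : R | 0 <= s <= T].

Lemma H1norm_ge_nrm (w : H1pair R d) : nrm Omega w.1 <= H1norm Omega w.
Proof.
rewrite /H1norm -[leLHS]ger0_norm ?sqrtr_ge0// -sqrtr_sqr.
by apply: ler_wsqrtr; rewrite lerDl sqr_ge0.
Qed.

Lemma H1norm_ge_vnrm (w : H1pair R d) : vnrm Omega w.2 <= H1norm Omega w.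
Proof.
rewrite /H1norm -[leLHS]ger0_norm ?sqrtr_ge0// -sqrtr_sqr.
by apply: ler_wsqrtr; rewrite lerDr sqr_ge0.
Qed.

Let cvg1 t : 0 <= t <= T ->
  nrm Omega ((s - t)^-1 *: ((u s).1 - (u t).1) - (ut t).1)
    @[s --> within D t^'] --> (0 : R).
Proof.
move=> /dut; apply: (squeeze_cvgr _ (cvg_cst 0)).
by apply: nearW => s; rewrite sqrtr_ge0 /=; exact: (H1norm_ge_nrm (_ *: (u s - u t) - ut t)).
Qed.

Let cvg2 t : 0 <= t <= T ->
  vnrm Omega ((s - t)^-1 *: ((u s).2 - (u t).2) - (ut t).2)
    @[s --> within D t^'] --> (0 : R).
Proof.
move=> /dut; apply: (squeeze_cvgr _ (cvg_cst 0)).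
by apply: nearW => s; rewrite sqrtr_ge0 /=; exact: (H1norm_ge_vnrm (_ *: (u s - u t) - ut t)).
Qed.

Lemma ip_derivative_on : derivative_on T (fun t => ip Omega (u t).1 (u t).1)
  (fun t => 2 * ip Omega (u t).1 (ut t).1).
Proof.
move=> t tT; apply: (sip_curve_derivative (ip_semi_inner_product mO)) (cvg1 tT).
- exact: tT.
- by move=> s /H1u[[]].
- by have [_ []] := H1u tT.
Qed.

Lemma vip_derivative_on : derivative_on T (fun t => vip Omega (u t).2 (u t).2)
  (fun t => 2 * vip Omega (u t).2 (ut t).2).
Proof.
move=> t tT; apply: (sip_curve_derivative (vip_semi_inner_product mO)) (cvg2 tT).
- exact: tT.
- by move=> s /H1u[[]].
- by have [_ []] := H1u tT.
Qed.

(** Every time [t] is a limit of times at which the bound holds, along which [u]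
    converges to [u t] in [L2]. *)
Lemma Linfty_bound_everywhere (C : R) : 0 < T ->
  (Linfty_Linfty_norm Omega T u <= C%:E)%E -> forall t, 0 <= t <= T ->
  {ae mu, forall x, Omega x -> `|(u t).1 x| <= C}.
Proof.
move=> T0 uC t tT.
have L2u s : 0 <= s <= T -> L2 Omega (u s).1 by move=> /H1u[[]].
apply: (L2_closed_bound mO (L2u _ tT)) => e e0.
have : nrm Omega ((u s).1 - (u t).1) @[s --> within D t^'] --> (0 : R).
  apply: (sip_curve_increment (ip_semi_inner_product mO)) (cvg1 tT) => //.
  by have [_ []] := H1u tT.
move=> /cvgrPdist_lt/(_ e e0).
rewrite /within /dnbhs /within /= => /nbhs_ballP[r /= r0 near_t].
have [||s sr sC] := @ae_itv_nonempty R
    (fun s => 0 < s < T -> {ae mu, forall x, Omega x -> `|(u s).1 x| <= C})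
    (Num.max 0 (t - r)) (Num.min T (t + r)).
- by rewrite gt_max !lt_min; lra.
- apply: filterS (ess_sup_ge lebesgue_measure
    ((fun t => Linfty_norm Omega (u t).1) \_ [set t : R | 0 < t < T])) => s us sT.
  have {us} : (Linfty_norm Omega (u s).1 <= C%:E)%E.
    by move: us; rewrite patchE mem_set// => us; exact: le_trans us uC.
  move=> usC; apply: filterS (ess_sup_ge mu
    (fun x => `|((u s).1 \_ Omega) x|%:E)) => x ux Ox.
  have : (`|((u s).1 \_ Omega) x|%:E <= C%:E)%E by exact: le_trans ux usC.
  by rewrite patchE mem_set// lee_fin.
have {sr} [sT sr] : 0 < s < T /\ `|t - s| < r.
  move: sr; rewrite gt_max lt_min => /andP[/andP[? ?] /andP[? ?]]; split; first lra.
  by rewrite ltr_norml; lra.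
exists (u s).1; split; [by apply: L2u; lra|exact: sC|].
(* The approximation is along the punctured neighborhoods of [t]. *)
have [->|st] := eqVneq s t.
  have ipS := ip_semi_inner_product mO; have Lt := L2u _ tT.
  rewrite subrr -(scale0r (u t).1) /nrm (sip_scalel ipS)//.
    by rewrite mul0r sqrtr0.
  exact: sip_closedZ ipS _ _ Lt.
have := near_t s sr st ltac:(lra).
by rewrite sub0r normrN ger0_norm ?sqrtr_ge0.
Qed.

End curves.

(** * Energy estimates for the semi-discrete scheme *)

Section energy_estimates.
Context {R : realType} {d : nat}.
Variables (Omega : set 'rV[R]_d) (f : R -> R) (beta gamma T : R).
Variables (S : set (H1pair R d)) (u v ut vt : R -> H1pair R d).
Hypotheses (mO : measurable Omega) (Ofin : (lebesgue_rV d Omega < +oo)%E).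
Hypotheses (beta0 : 0 < beta) (gamma0 : 0 < gamma) (T0 : 0 < T).
Hypothesis SH1 : S `<=` H1 Omega.
Hypothesis St : forall t, 0 <= t <= T -> [/\ S (u t), S (v t), S (ut t) & S (vt t)].
Hypotheses (du : time_derivative Omega T u ut) (dv : time_derivative Omega T v vt).
Hypotheses (equ : equation_u Omega f beta T S u v ut).
Hypotheses (eqv : equation_v Omega f gamma T S u v vt).
Variables (C F M : R).
Hypotheses (cf : continuous f) (cf' : continuous (derive1 f)).
Hypotheses (F0 : 0 <= F) (fF : forall z, `|z| <= C -> `|f z| <= F).
Hypotheses (M0 : 0 <= M) (fM : forall z, `|z| <= C -> `|derive1 f z| <= M).
Hypothesis uC : forall t, 0 <= t <= T ->
  {ae lebesgue_rV d, forall x, Omega x -> `|(u t).1 x| <= C}.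
Hypothesis v0 : ip Omega (v 0).1 (v 0).1 = 1.

Let ipS := ip_semi_inner_product mO.
Let vipS := vip_semi_inner_product mO.
Let vol := nrm Omega (cst 1 : 'rV[R]_d -> R).

Let L2u t : 0 <= t <= T -> L2 Omega (u t).1.
Proof. by move=> /St[/SH1[]]. Qed.

Let L2v t : 0 <= t <= T -> L2 Omega (v t).1.
Proof. by move=> /St[_ /SH1[]]. Qed.

Let L2ut t : 0 <= t <= T -> L2 Omega (ut t).1.
Proof. by move=> /St[_ _ /SH1[]]. Qed.

Let L2vt t : 0 <= t <= T -> L2 Omega (vt t).1.
Proof. by move=> /St[_ _ _ /SH1[]]. Qed.

Let y t := ip Omega (v t).1 (v t).1.
Let W t := vip Omega (v t).2 (v t).2.
Let U t := vip Omega (u t).2 (u t).2.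

Let dy : derivative_on T y (fun t => 2 * ip Omega (v t).1 (vt t).1).
Proof. by apply: ip_derivative_on => // t /St[_ /SH1 ? _ /SH1]. Qed.

Let dW : derivative_on T W (fun t => 2 * vip Omega (v t).2 (vt t).2).
Proof. by apply: vip_derivative_on => // t /St[_ /SH1 ? _ /SH1]. Qed.

Let dU : derivative_on T U (fun t => 2 * vip Omega (u t).2 (ut t).2).
Proof. by apply: vip_derivative_on => // t /St[/SH1 ? _ /SH1]. Qed.

Let reaction_v t k : 0 <= t <= T -> L2 Omega k ->
  `|ip Omega ((derive1 f \o (u t).1) \* (v t).1) k| <=
    M * nrm Omega (v t).1 * nrm Omega k.
Proof.
move=> tT Lk; have [mu _] := L2u tT.
have [Lr le_r] := superposition_bound mO cf' fM mu (uC tT) (L2v tT).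
apply: le_trans (sip_cauchy_schwarz ipS Lr Lk) _.
by rewrite ler_wpM2r ?sqrtr_ge0//; move: le_r; rewrite ger0_norm.
Qed.

Let reaction_u t k : 0 <= t <= T -> L2 Omega k ->
  `|ip Omega (f \o (u t).1) k| <= F * vol * nrm Omega k.
Proof.
move=> tT Lk; have [mu _] := L2u tT.
have [] := superposition_bound mO cf fF mu (uC tT) (L2_cst1 mO Ofin).
rewrite (_ : _ \* cst 1 = f \o (u t).1); last first.
  by apply/funext => x; rewrite /= mulr1.
move=> Lr le_r; apply: le_trans (sip_cauchy_schwarz ipS Lr Lk) _.
by rewrite ler_wpM2r ?sqrtr_ge0//; move: le_r; rewrite ger0_norm.
Qed.

(** The second equation tested with [v]. *)
Let y_rate t : 0 <= t <= T -> ip Omega (v t).1 (vt t).1 =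
  gamma * (1 - y t) *
    (ip Omega ((derive1 f \o (u t).1) \* (v t).1) (v t).1 - W t).
Proof.
move=> tT; have [_ Sv _ _] := St tT.
have := eqv tT Sv; rewrite -/(W t) -/(y t).
rewrite (ipC Omega (v t).1 (_ \* _)) (ipC Omega (vt t).1).
set r := ip _ (_ \* _) _; set p := ip _ _ (vt t).1 => e.
have -> : p = gamma * (gamma^-1 * p) by rewrite mulrA divff ?mul1r ?gt_eqF.
by rewrite -!mulrA; congr (_ * _); move: e; lra.
Qed.

(** [(1 - y)^2] has derivative at most [a (1 - y)^2] for some [a], and starts from 0.
    The constant [a] comes from the compactness of [0, T] and depends on the mesh, which
    is harmless because the conclusion does not mention it. *)
Lemma director_unit t : 0 <= t <= T -> ip Omega (v t).1 (v t).1 = 1.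
Proof.
move=> tT.
have [Y yY] := derivative_on_bounded dy (ltW T0).
have [K WK] := derivative_on_bounded dW (ltW T0).
have T00 : 0 <= (0 : R) <= T by rewrite lexx ltW.
have Y0 : 0 <= Y by apply: le_trans (yY _ T00); exact: ip_ge0.
have K0 : 0 <= K by apply: le_trans (WK _ T00); exact: (sip_ge0 vipS).
have a0 : 0 < 4 * gamma * (M * Y + K) + 1.
  have := mulr_ge0 M0 Y0 => MY.
  by rewrite ltr_wpDl// mulr_ge0 ?mulr_ge0 ?addr_ge0// ltW.
have := gronwall (derivative_on_sqr dy (c := 1)) a0 (lexx 0) _ (sqr_ge0 _) tT.
rewrite (_ : y 0 = 1)// subrr expr0n mul0r addr0 mulr0 => small.
suff : (1 - y t) ^+ 2 <= 0.
  by rewrite real_exprn_even_le0 ?num_real//= subr_eq0 => /eqP.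
apply: small => s sT'.
have sT : 0 <= s <= T by lra.
rewrite addr0 y_rate//.
set r := ip _ (_ \* _) _.
have rMY : `|r| <= M * Y.
  apply: le_trans (reaction_v sT (L2v sT)) _.
  rewrite -mulrA -expr2 sqr_sqrtr ?ip_ge0// ler_wpM2l//; exact: yY.
have {}rMY : - (M * Y) <= r by move: rMY; rewrite ler_norml => /andP[].
have WsK := WK _ sT.
have z0 := sqr_ge0 (1 - y s).
have : 4 * gamma * (1 - y s) ^+ 2 * (W s - r) <= 4 * gamma * (1 - y s) ^+ 2 * (M * Y + K).
  by rewrite ler_wpM2l; [lra|rewrite mulr_ge0// mulr_ge0// ltW|lra].
have -> : - 2 * (1 - y s) * (2 * (gamma * (1 - y s) * (r - W s))) =
  4 * gamma * (1 - y s) ^+ 2 * (W s - r) by ring.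
move=> /le_trans; apply; rewrite -subr_ge0.
by rewrite [leRHS](_ : _ = (1 - y s) ^+ 2)//; ring.
Qed.

Let v_unit t : 0 <= t <= T -> nrm Omega (v t).1 = 1.
Proof. by move=> tT; rewrite /nrm director_unit// sqrtr1. Qed.

Let v_vt_orthogonal t : 0 <= t <= T -> ip Omega (v t).1 (vt t).1 = 0.
Proof.
by move=> tT; rewrite y_rate// /y director_unit// subrr mulr0 mul0r.
Qed.

(** The second equation tested with [vt], where [(v, vt) = 0] removes the cubic terms.
    The rate is bounded by a constant; the exponential comes from using Gronwall's
    lemma with [a = 1] rather than a separate argument for [a = 0]. *)
Lemma grad_v_bound t : 0 <= t <= T ->
  vip Omega (v t).2 (v t).2 <=
    expR T * (vip Omega (v 0).2 (v 0).2 + gamma * M ^+ 2).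
Proof.
move=> tT.
have b0 : 0 <= gamma * M ^+ 2 by rewrite mulr_ge0 ?sqr_ge0 ?ltW.
have := gronwall dW ltr01 b0 _ (sip_ge0 vipS _) tT.
rewrite mul1r divr1; apply => s sT'.
have sT : 0 <= s <= T by lra.
have Ws0 : 0 <= W s by exact: (sip_ge0 vipS).
have [_ _ _ Svt] := St sT.
have := eqv sT Svt; rewrite v_vt_orthogonal// !mulr0 !subr0 => e.
have := reaction_v sT (L2vt sT); rewrite v_unit// mulr1.
move: e; set r := ip _ (_ \* _) _; set n := nrm _ _.
have -> : ip Omega (vt s).1 (vt s).1 = n ^+ 2 by rewrite sqr_sqrtr ?ip_ge0.
set q := vip _ _ _ => e /(le_trans (ler_norm _)) rMn.
(* Young: [M n <= n^2 / gamma + gamma M^2 / 4]. *)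
have sq : 0 <= gamma^-1 * (2 * n - gamma * M) ^+ 2.
  by rewrite mulr_ge0 ?invr_ge0 ?sqr_ge0 ?ltW.
have E : gamma^-1 * (2 * n - gamma * M) ^+ 2 =
    4 * (gamma^-1 * n ^+ 2) - 4 * (M * n) + gamma * M ^+ 2.
  by field; exact: lt0r_neq0.
rewrite E in sq; lra.
Qed.

(** The first equation tested with [ut].  The term [2 (grad v, grad u) (v, ut)] does
    not cancel; it is linear in [||grad u||] thanks to the bound on [grad v], hence
    within the reach of Gronwall's lemma.  The factor 9 is the square of the three
    contributions of the reaction, one from [(f(u), ut)] and two from
    [2 (v, f(u)) (v, ut)]. *)
Lemma grad_u_bound K t : 0 <= K ->
  (forall s, 0 <= s <= T -> vip Omega (v s).2 (v s).2 <= K ^+ 2) ->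
  0 <= t <= T ->
  vip Omega (u t).2 (u t).2 <=
    expR ((4 * beta * K ^+ 2 + 1) * T) *
    (vip Omega (u 0).2 (u 0).2 + 9 * beta * (F * vol) ^+ 2).
Proof.
move=> K0 WK tT.
have vol0 : 0 <= vol by exact: sqrtr_ge0.
set G := F * vol; have G0 : 0 <= G by exact: mulr_ge0.
set b := 9 * beta * G ^+ 2.
have b0 : 0 <= b by rewrite mulr_ge0 ?sqr_ge0// mulr_ge0 ?ltW.
set a := 4 * beta * K ^+ 2 + 1.
have aK0 : 0 <= 4 * beta * K ^+ 2 by rewrite mulr_ge0 ?sqr_ge0// mulr_ge0 ?ltW.
have a0 : 0 < a by rewrite ltr_wpDl.
have U0 s : 0 <= U s by exact: (sip_ge0 vipS).
apply: (@le_trans _ _ (expR (a * T) * (U 0 + b / a))); last first.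
  rewrite ler_wpM2l ?expR_ge0// lerD2l ler_pdivrMr// ler_peMr//.
  by rewrite lerDr.
apply: (gronwall dU a0 b0 _ (U0 0) tT) => s sT'.
have sT : 0 <= s <= T by lra.
have [Su Sv Sut _] := St sT.
have := equ sT Sut.
set n := nrm Omega (ut s).1.
have n0 : 0 <= n by exact: sqrtr_ge0.
have -> : ip Omega (ut s).1 (ut s).1 = n ^+ 2 by rewrite sqr_sqrtr ?ip_ge0.
have := reaction_u sT (L2ut sT); have := reaction_u sT (L2v sT).
rewrite v_unit// mulr1 -/G -/n (ipC Omega (v s).1 (f \o _)).
have := sip_cauchy_schwarz ipS (L2v sT) (L2ut sT).
rewrite -/(nrm _ _) v_unit// mul1r -/(nrm _ _) -/n.
have vL2v : vL2 Omega (v s).2 by have [] := SH1 Sv.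
have vL2u : vL2 Omega (u s).2 by have [] := SH1 Su.
have := sip_cauchy_schwarz vipS vL2v vL2u; rewrite -/(U s).
set x := Num.sqrt (U s); have x0 : 0 <= x by exact: sqrtr_ge0.
have -> : U s = x ^+ 2 by rewrite sqr_sqrtr.
have /(ler_wsqrtr) := WK _ sT; rewrite sqrtr_sqr ger0_norm// => WsK.
move=> /le_trans /(_ (ler_wpM2r x0 WsK)).
set A := vip Omega (v s).2 (u s).2; set B := ip Omega (v s).1 (ut s).1.
set D := ip Omega (f \o _) (v s).1; set E := ip Omega (f \o _) (ut s).1.
set q := vip Omega (u s).2 (ut s).2 => hA hB hD hE e.
have hAB : A * B <= K * x * n.
  apply: le_trans (ler_norm _) _; rewrite normrM; exact: ler_pM.
have hDB : - (D * B) <= G * n.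
  rewrite -normrN in hD.
  by apply: le_trans (ler_norm _) _; rewrite -mulNr normrM; apply: ler_pM.
have hE' : E <= G * n by exact: le_trans (ler_norm _) hE.
pose m := 2 * K * x + 3 * G.
(* Young: [m n <= n^2 / beta + beta m^2 / 4]. *)
have sq : 0 <= beta^-1 * (2 * n - beta * m) ^+ 2.
  by rewrite mulr_ge0 ?invr_ge0 ?sqr_ge0 ?ltW.
have Esq : beta^-1 * (2 * n - beta * m) ^+ 2 =
    4 * (beta^-1 * n ^+ 2) - 4 * (m * n) + beta * m ^+ 2.
  by field; exact: lt0r_neq0.
(* [(p + q)^2 <= 2 (p^2 + q^2)] with [p = 2 K x] and [q = 3 G]. *)
have m2 : 0 <= beta * (2 * K * x - 3 * G) ^+ 2.
  by rewrite mulr_ge0 ?sqr_ge0 ?ltW.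
have mE : beta * m ^+ 2 + beta * (2 * K * x - 3 * G) ^+ 2 =
  2 * (4 * beta * K ^+ 2 * x ^+ 2 + b) by rewrite /m /b; ring.
have mn : m * n = 2 * (K * x * n) + 3 * (G * n) by rewrite /m; ring.
have ax : a * x ^+ 2 = 4 * beta * K ^+ 2 * x ^+ 2 + x ^+ 2 by rewrite /a; ring.
have x2 := sqr_ge0 x.
rewrite Esq mn in sq; rewrite ax.
have e' : beta^-1 * n ^+ 2 + q = 2 * (A * B) + E - 2 * (D * B).
  by move: e; rewrite -!mulrA; lra.
lra.
Qed.

End energy_estimates.

(** * The nonlinearity and the initial data *)

Section local_lipschitz.
Context {R : realType}.
Variable f : R -> R.
Hypothesis hA : assumptionA f.

Lemma assumptionA_continuous : continuous f.
Proof.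
by move=> z; apply: differentiable_continuous; apply/derivable1_diffP; exact: hA.1.
Qed.

Lemma assumptionA_continuous_derive1 : continuous (derive1 f).
Proof.
move=> z.
have [|L L0 lip] := hA.2 (`|z| + 1); first by rewrite ltr_wpDl.
apply/cvgrPdist_lt => e e0.
have r0 : 0 < Num.min 1 (e / L) by rewrite lt_min ltr01 divr_gt0.
apply: filterS (nbhsx_ballx z _ r0) => s zs.
move: zs; rewrite /ball /= lt_min ltr_pdivlMr// mulrC => /andP[zs1 zsL].
have bz : - (`|z| + 1) <= z <= `|z| + 1.
  by rewrite -ler_norml lerDl.
have bs : - (`|z| + 1) <= s <= `|z| + 1.
  rewrite -ler_norml; have := lerB_dist s z; rewrite distrC; lra.
have := lip _ _ bz bs; have := normr_ge0 (f z - f s); lra.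
Qed.

Lemma assumptionA_bounded (C : R) : 0 < C -> exists2 M : R, 0 <= M &
  forall z, `|z| <= C -> `|f z| <= M /\ `|derive1 f z| <= M.
Proof.
move=> C0; have [L L0 lip] := hA.2 C C0.
exists (`|f 0| + `|derive1 f 0| + L * C); first by do 2?apply: addr_ge0 => //; rewrite mulr_ge0 // ltW.
move=> z zC; have b0 : - C <= 0 <= C by lra.
have := lip z 0 ltac:(by rewrite -ler_norml) b0; rewrite subr0 => lipz.
have : L * `|z| <= L * C by rewrite ler_pM2l.
have := lerB_dist (f z) (f 0); have := lerB_dist (derive1 f z) (derive1 f 0).
have := normr_ge0 (f z - f 0); have := normr_ge0 (derive1 f z - derive1 f 0).
have := normr_ge0 (f 0); have := normr_ge0 (derive1 f 0).
by move=> *; split; lra.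
Qed.

End local_lipschitz.

Section initial_data.
Context {R : realType} {d : nat}.
Variable Omega : set 'rV[R]_d.
Hypothesis mO : measurable Omega.

Lemma vip_ae_eq (F G : 'rV[R]_d -> 'rV[R]_d) : vL2 Omega F -> vL2 Omega G ->
  {ae lebesgue_rV d, forall x, Omega x -> F x = G x} ->
  vip Omega F F = vip Omega G G.
Proof.
move=> LF LG FG; rewrite !vip_sum_ip//; apply: eq_bigr => i _.
apply: ip_ae_eq => //; first by have [] := LF i.
by apply: filterS FG => x /[apply] ->.
Qed.

Lemma elliptic_projection_grad_le (M : mesh R d) P g :
  elliptic_projection Omega (fe_space Omega M) P -> H10 Omega g ->
  vip Omega (P g).2 (P g).2 <= vip Omega g.2 g.2.
Proof.
move=> Pell H10g; have [SPg Pgorth] := Pell g H10g.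
have [[[_ LPg _] _] _ _ _] := SPg; have [[_ Lg _] _] := H10g.
apply: (sip_pythagoras (vip_semi_inner_product mO)) => //.
exact: Pgorth.
Qed.

End initial_data.

(** * The gradient bound *)

Unset Implicit Arguments.
Set Strict Implicit.

Theorem lemma3p1 (R : realType) (d : nat) (hd : (1 <= d <= 3)%N)
  (Omega : set 'rV[R]_d) (hOmega : smooth_bounded_domain Omega)
  (beta gamma T : R) (hbeta : 0 < beta) (hgamma : 0 < gamma) (hT : 0 < T)
  (f : R -> R) (hA : assumptionA f)
  (u0 v0 : H1pair R d) (hu0 : H2_H10 Omega u0) (hv0 : H2_H10 Omega v0)
  (hv0_nrm : nrm Omega v0.1 = 1)
  (C0 : R) (hC0 : 0 < C0) :
  exists2 Q : R, 0 < Q &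
    forall (Hs : set R) (Th : R -> mesh R d) (P : R -> H1pair R d -> H1pair R d),
      quasi_uniform_family Omega Hs Th ->
      (forall h, Hs h -> elliptic_projection Omega (fe_space Omega (Th h)) (P h)) ->
      projection_error_estimate Omega Hs P ->
      (forall h, Hs h -> 2^-1 <= nrm Omega (P h v0).1) ->
    forall h0 : R, 0 < h0 ->
      assumptionB Omega f beta gamma T Hs Th P u0 v0 h0 C0 ->
    forall (h : R) (u v : R -> H1pair R d), Hs h -> 0 < h < h0 ->
      semidiscrete_solution Omega f beta gamma T (fe_space Omega (Th h)) (P h)
        u0 v0 u v ->
    forall t : R, 0 <= t <= T ->
      vnrm Omega (u t).2 + vnrm Omega (v t).2 <= Q.
Proof.
have [oO _ _ bO _] := hOmega.
have mO : measurable Omega by exact: open_measurable_rV.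
have Ofin : (lebesgue_rV d Omega < +oo)%E by exact: lebesgue_rV_bounded.
have vipS := vip_semi_inner_product mO.
have [M M0 fM] := assumptionA_bounded hA hC0.
set vol := nrm Omega (cst 1 : 'rV[R]_d -> R).
set W := expR T * (4 * vip Omega v0.2 v0.2 + gamma * M ^+ 2).
set U := expR ((4 * beta * Num.sqrt W ^+ 2 + 1) * T) *
  (vip Omega u0.2 u0.2 + 9 * beta * (M * vol) ^+ 2).
exists (Num.sqrt U + Num.sqrt W + 1); first by rewrite ltr_wpDl// addr_ge0 ?sqrtr_ge0.
move=> Hs Th P _ Pell _ Pv0 h0 h0_gt0 hB h u v Hh hh0 sol.
have uC := hB h u v Hh hh0 sol.
have [ut [vt [St [du dv] [equ eqv] u0E v0E]]] := sol.
have SH1 : fe_space Omega (Th h) `<=` H1 Omega by move=> w [[]].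
have H1u t : 0 <= t <= T -> H1 Omega (u t) /\ H1 Omega (ut t).
  by move=> /St[/SH1 ? _ /SH1].
have T00 : 0 <= (0 : R) <= T by rewrite lexx ltW.
have [Su0 Sv0 _ _] := St 0 T00.
have [L2v0 vL2v0 _] := SH1 _ Sv0; have [_ vL2u0 _] := SH1 _ Su0.
have H10v : H10 Omega v0 by case: hv0.
have H10u : H10 Omega u0 by case: hu0.
have [/SH1 [L2Pv vL2Pv _] _] := Pell h Hh v0 H10v.
have [/SH1 [_ vL2Pu _] _] := Pell h Hh u0 H10u.
have ipS := ip_semi_inner_product mO.
(* [v 0 = P v0 / ||P v0||] and [||P v0|| >= 1/2], hence the factor 4. *)
set a := nrm Omega (P h v0).1 in v0E.
have a2 : 2^-1 <= a by exact: Pv0.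
have a0 : 0 < a by lra.
have v0_unit : ip Omega (v 0).1 (v 0).1 = 1.
  rewrite (ip_ae_eq mO (g := a^-1 *: (P h v0).1)).
  - rewrite (sip_scalel ipS)//; last exact: (sip_closedZ ipS).
    rewrite ipC (sip_scalel ipS)// -[ip _ _ _]sqr_sqrtr ?ip_ge0// -/(nrm _ _) -/a.
    by field; exact: lt0r_neq0.
  - by case: L2v0.
  - exact: (sip_closedZ ipS).
  - by apply: filterS v0E => x /[apply] -[].
have gv0 : vip Omega (v 0).2 (v 0).2 <= 4 * vip Omega v0.2 v0.2.
  rewrite (vip_ae_eq mO (G := a^-1 *: (P h v0).2))//.
  - rewrite (sip_scalel vipS)//; last exact: (sip_closedZ vipS).
    rewrite (sip_sym vipS) (sip_scalel vipS)// mulrA.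
    apply: ler_pM; rewrite ?(sip_ge0 vipS)//.
    + by rewrite mulr_ge0// invr_ge0 ltW.
    + have : a^-1 <= 2 by rewrite invf_ple ?posrE.
      have : 0 < a^-1 by rewrite invr_gt0.
      nra.
    + exact: elliptic_projection_grad_le mO _ _ _ (Pell h Hh) H10v.
  - exact: (sip_closedZ vipS).
  - by apply: filterS v0E => x /[apply] -[].
have gu0 : vip Omega (u 0).2 (u 0).2 <= vip Omega u0.2 u0.2.
  rewrite (vip_ae_eq mO (G := (P h u0).2))//.
    exact: elliptic_projection_grad_le mO _ _ _ (Pell h Hh) H10u.
  by apply: filterS u0E => x /[apply] -[].
have uC0 := Linfty_bound_everywhere mO H1u du hT uC.
have cf := assumptionA_continuous hA.
have cf' := assumptionA_continuous_derive1 hA.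
have fM1 z : `|z| <= C0 -> `|f z| <= M by move=> /fM[].
have fM2 z : `|z| <= C0 -> `|derive1 f z| <= M by move=> /fM[].
have W0 : 0 <= W.
  by rewrite mulr_ge0 ?expR_ge0// addr_ge0 ?mulr_ge0 ?sqr_ge0 ?(sip_ge0 vipS)// ltW.
have WW t : 0 <= t <= T -> vip Omega (v t).2 (v t).2 <= W.
  move=> tT.
  apply: le_trans (grad_v_bound mO hgamma hT SH1 St dv eqv cf' M0 fM2 uC0 v0_unit tT) _.
  by rewrite ler_wpM2l ?expR_ge0// lerD2r.
have UU t : 0 <= t <= T -> vip Omega (u t).2 (u t).2 <= U.
  move=> tT.
  have WW' s : 0 <= s <= T -> vip Omega (v s).2 (v s).2 <= Num.sqrt W ^+ 2.
    by rewrite sqr_sqrtr//; exact: WW.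
  apply: le_trans (grad_u_bound mO Ofin hbeta hgamma hT SH1 St du dv equ eqv
    cf cf' M0 fM1 M0 fM2 uC0 v0_unit (sqrtr_ge0 _) WW' tT) _.
  by rewrite ler_wpM2l ?expR_ge0// lerD2r.
move=> t tT.
have := ler_wsqrtr (UU _ tT); have := ler_wsqrtr (WW _ tT).
rewrite -!/(vnrm _ _); lra.
Qed.
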